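(* For all integers $n\ge2$ and $k,d\ge1$, the group $\mathrm{RTM}(\mathbb{Z}^d,n,k)$ of reversible Turing machines is not residually finite.
   Context: Let $\Sigma=\{0,\dots,n-1\}$, $Q=\{1,\dots,k\}$. Let $X_k=\{y\in\{0,1,\dots,k\}^{\mathbb{Z}^d} : y_{\vec u}\ne0\text{ and }y_{\vec v}\neq 0\implies \vec u=\vec v\}$ and $X_{n,k}=\Sigma^{\mathbb{Z}^d}\times X_k$. Given finite $F,F'\subset\mathbb{Z}^d$ and $f:\Sigma^F\times Q\to\Sigma^{F'}\times Q\times\mathbb{Z}^d$ (a local rule), the map $T_f:X_{n,k}\to X_{n,k}$ is defined by: $T_f(x,y)=(x,y)$ if $y$ is identically $0$; otherwise let $\vec v$ be the unique position with $q=y_{\vec v}\ne 0$, let $p\in\Sigma^F$ with $p_{\vec u}=x_{\vec v+\vec u}$, and $f(p,q)=(p',q',\vec e)$; then $T_f(x,y)=(\tilde x,\tilde y)$ with $\tilde x_{\vec t}=p'_{\vec t-\vec v}$ if $\vec t-\vec v\in F'$, $\tilde x_{\vec t}=x_{\vec t}$ otherwise, and $\tilde y_{\vec v+\vec e}=q'$, $\tilde y_{\vec t}=0$ for $\vec t\ne\vec v+\vec e$. Such maps are the $(d,n,k)$-Turing machines; one is reversible if it has a two-sided inverse that is a $(d,n,k)$-Turing machine. The reversible ones form the group $\mathrm{RTM}(\mathbb{Z}^d,n,k)$ under composition. *)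

(* Defs.v *)
From HB Require Import structures.
From mathcomp Require Import all_boot all_order all_algebra all_fingroup.
From mathcomp Require Import finmap.
From mathcomp Require Import boolp.

Set Implicit Arguments.
Unset Strict Implicit.
Unset Printing Implicit Defensive.

Import GRing.Theory.
Local Open Scope fset_scope.
Local Open Scope ring_scope.

Notation Zd d := 'rV[int]_d.

(* The value ord0 marks the absence of the head; the actual states are the
   nonzero elements of {0, ..., k}. *)
Notation state k := {q : 'I_k.+1 | q != ord0}.

Definition tape (d n : nat) : Type := Zd d -> 'I_n.

Definition head_config (d k : nat) : Type :=
  {y : Zd d -> 'I_k.+1 |
    forall u v, y u != ord0 -> y v != ord0 -> u = v}.

Definition config (d n k : nat) : Type := (tape d n * head_config d k)%type.

Section TuringMaps.
Variables d n k : nat.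
Implicit Types (x w : tape d n) (y : head_config d k) (q : state k) (t u v e : Zd d).

Lemma head_at_subproof q v :
  let y := fun t : Zd d => if t == v then val q else ord0 in
  forall t u, y t != ord0 -> y u != ord0 -> t = u.
Proof.
by move=> /= t u; case: (t =P v) => [->|_]; case: (u =P v) => [->|_];
  rewrite ?eqxx.
Qed.

Definition head_at q v : head_config d k := exist _ _ (head_at_subproof (q := q) (v := v)).

Definition turing_map (F F' : {fset Zd d})
    (f : {ffun F -> 'I_n} * state k -> {ffun F' -> 'I_n} * state k * Zd d)
    (c : config d n k) : config d n k :=
  let: (x, y) := c in
  match pselect (exists v, sval y v != ord0) with
  | left nz =>
      let v := sval (cid nz) in
      let q : state k := Sub (sval y v) (svalP (cid nz)) in
      let p := [ffun u : F => x (v + val u)] in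
      let: (p', q', e) := f (p, q) in
      (fun t => if insub (t - v) is Some u then p' u else x t,
       head_at q' (v + e))
  | right _ => c
  end.

Definition is_turing (T : config d n k -> config d n k) : Prop :=
  exists (F F' : {fset Zd d})
    (f : {ffun F -> 'I_n} * state k -> {ffun F' -> 'I_n} * state k * Zd d),
    T =1 turing_map f.

Definition reversible (T : config d n k -> config d n k) : Prop :=
  is_turing T /\
  exists S, [/\ is_turing S, cancel T S & cancel S T].

Lemma head0_subproof (t u : Zd d) :
  (ord0 : 'I_k.+1) != ord0 -> (ord0 : 'I_k.+1) != ord0 -> t = u.
Proof. by rewrite eqxx. Qed.

Definition head0 : head_config d k := exist _ (fun=> ord0) head0_subproof.

Lemma head_eq y1 y2 : sval y1 =1 sval y2 -> y1 = y2.
Proof. by case: y1 y2 => [y1 h1] [y2 h2] /= /funext E; apply: eq_exist. Qed.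

Lemma headP y : y = head0 \/ exists q v, y = head_at q v.
Proof.
have [[v nz]|z] := pselect (exists v, sval y v != ord0).
  right; exists (Sub (sval y v) nz), v; apply: head_eq => t /=.
  case: eqP => [->//|ne]; apply/eqP/negPn/negP => nt.
  by apply: ne; apply: (svalP y).
left; apply: head_eq => t /=; apply/eqP/negPn/negP => nt.
by apply: z; exists t.
Qed.

Section MapE.
Variables (F F' : {fset Zd d})
  (f : {ffun F -> 'I_n} * state k -> {ffun F' -> 'I_n} * state k * Zd d).

Lemma turing_map0 x : turing_map f (x, head0) = (x, head0).
Proof.
rewrite /turing_map; case: pselect => // nz; exfalso.
by case: nz => v /negP[].
Qed.

Lemma turing_mapE x q v (r := f ([ffun u : F => x (v + val u)], q)) :
  turing_map f (x, head_at q v) =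
    (fun t => if insub (t - v) is Some u then r.1.1 u else x t,
     head_at r.1.2 (v + r.2)).
Proof.
rewrite /r /turing_map; case: pselect => [nz|[]]; last first.
  by exists v => /=; rewrite eqxx; apply: (valP q).
move: (svalP (cid nz)); set v' := sval (cid nz) => nz'.
have E : v' = v.
  by move: nz' => /=; case: (v' =P v) => //; rewrite eqxx.
move: nz'; rewrite E => nz'.
have -> : Sub (sval (head_at q v) v) nz' = q.
  by apply: val_inj; rewrite SubK /= eqxx.
by case: (f _) => [[p' q'] e].
Qed.

End MapE.

(* T acts through a rule g reading the tape as seen from the head.  Unlike the
   finite local rules, such rules compose directly, which is how closure of
   Turing machines under composition is obtained below. *)
Definition local_form (T : config d n k -> config d n k) (N : {fset Zd d})
    (g : tape d n -> state k -> tape d n * state k * Zd d) : Prop :=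
  [/\ forall x, T (x, head0) = (x, head0),
      forall x q v, T (x, head_at q v) =
        let r := g (fun u => x (v + u)) q in
        (fun t => r.1.1 (t - v), head_at r.1.2 (v + r.2)),
      forall w w' q, {in N, w =1 w'} ->
        [/\ {in N, (g w q).1.1 =1 (g w' q).1.1},
            (g w q).1.2 = (g w' q).1.2 & (g w q).2 = (g w' q).2] &
      forall w q t, t \notin N -> (g w q).1.1 t = w t].

Lemma turing_local T : is_turing T ->
  exists N g (E : {fset Zd d}),
    local_form T N g /\ forall w q, (g w q).2 \in E.
Proof.
move=> [F [F' [f Tf]]].
pose fr w q := f ([ffun u : F => w (val u)], q).
exists (F `|` F').
exists (fun w q =>
  (fun t => if insub t is Some u then (fr w q).1.1 u else w t,
   (fr w q).1.2, (fr w q).2)).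
exists [fset (f a).2 | a : {ffun F -> 'I_n} * state k]; split; last first.
  by move=> w q /=; apply/imfsetP; exists ([ffun u : F => w (val u)], q).
split=> [x|x q v|w w' q ww'|w q t] /=.
- by rewrite Tf turing_map0.
- rewrite Tf turing_mapE; congr pair; apply: funext => t.
  by case: insub => //; rewrite addrC subrK.
- have -> : fr w q = fr w' q.
    rewrite /fr; congr (f (_, _)); apply/ffunP => u; rewrite !ffunE.
    by apply: ww'; rewrite inE (valP u).
  by split=> // t tN; case: insub => //; apply: ww'.
by rewrite inE negb_or => /andP[_ tF']; rewrite insubN.
Qed.

Lemma local_turing T N g : local_form T N g -> is_turing T.
Proof.
move=> [T0 TE gl gw]; pose M := 0 |` N.
have M0 : 0 \in M by rewrite fset1U1.
pose ext (p : {ffun M -> 'I_n}) : tape d n :=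
  fun t => if insub t is Some u then p u else p [` M0].
exists M, M.
exists (fun a => ([ffun u => (g (ext a.1) a.2).1.1 (val u)],
                  (g (ext a.1) a.2).1.2, (g (ext a.1) a.2).2)).
move=> [x y]; have [->|[q [v ->]]] := headP y; first by rewrite T0 turing_map0.
rewrite (turing_mapE _ x q v) TE /=.
set p := [ffun u : M => x (v + val u)]; set w := fun u => x (v + u).
have wp : {in M, w =1 ext p}.
  by move=> t tM; rewrite /ext insubT /p ffunE.
have wpN : {in N, w =1 ext p}.
  by move=> t tN; apply: wp; rewrite fset1Ur.
have [g1 g2 g3] := gl _ _ q wpN.
rewrite g2 g3; congr pair; apply: funext => t.
case: insubP => [u uM uE|].
  rewrite ffunE uE; case: (boolP (t - v \in N)) => tN; first exact: g1.
  by rewrite !gw // wp.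
rewrite in_fset1U negb_or => /andP[_ tN].
by rewrite gw // /w addrC subrK.
Qed.

Lemma is_turing_id : is_turing id.
Proof.
apply: (@local_turing id fset0 (fun w q => (w, q, 0))).
split=> //= x q v; rewrite addr0; congr pair.
by apply: funext => t; rewrite addrC subrK.
Qed.

Lemma is_turing_comp T S : is_turing T -> is_turing S -> is_turing (T \o S).
Proof.
move=> /turing_local[N2 [g2 [_ [[T0 TE gl2 gw2] _]]]].
move=> /turing_local[N1 [g1 [E [[S0 SE gl1 gw1] gE]]]].
pose N := N1 `|` [fset (e + u : Zd d) | e in E, u in N2].
pose h w q := g2 (fun u => (g1 w q).1.1 ((g1 w q).2 + u)) (g1 w q).1.2.
apply: (@local_turing _ N (fun w q =>
  (fun t => (h w q).1.1 (t - (g1 w q).2), (h w q).1.2,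
   (g1 w q).2 + (h w q).2))).
have NP t w q : t \notin N -> t \notin N1 /\ t - (g1 w q).2 \notin N2.
  rewrite inE negb_or => /andP[tN1 tN2]; split=> //.
  apply: contra tN2 => tN2; apply/imfset2P.
  exists (g1 w q).2; first exact: gE.
  by exists (t - (g1 w q).2) => //; rewrite addrC subrK.
split=> [x|x q v|w w' q ww'|w q t tN] /=.
- by rewrite S0 T0.
- rewrite SE /= TE /=.
  set r := g1 _ q.
  have -> : (fun u => r.1.1 (v + r.2 + u - v)) = (fun u => r.1.1 (r.2 + u)).
    by apply: funext => u; congr (r.1.1 _); rewrite [v + _]addrC -!addrA
      [v + _]addrC -!addrA addNr ?addr0 // subrK.
  rewrite -/r /h -/r addrA; congr pair; apply: funext => t.
  by congr (_ _); rewrite opprD addrA.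
- have ww1 : {in N1, w =1 w'} by move=> t tN; apply: ww'; rewrite inE tN.
  have [e1 e2 e3] := gl1 _ _ q ww1.
  have eN : {in N, (g1 w q).1.1 =1 (g1 w' q).1.1}.
    move=> t tN; case: (boolP (t \in N1)) => [/e1//|tN1].
    by rewrite !gw1 // ww'.
  have hN : {in N2, (fun u => (g1 w q).1.1 ((g1 w q).2 + u)) =1
                    (fun u => (g1 w' q).1.1 ((g1 w' q).2 + u))}.
    move=> u uN; rewrite -e3; apply: eN; rewrite inE; apply/orP; right.
    by apply/imfset2P; exists (g1 w q).2; [apply: gE|exists u].
  rewrite /h -e2; have [f1 f2 f3] := gl2 _ _ (g1 w q).1.2 hN.
  rewrite f2 f3 -e3; split=> // t tN.
  case: (boolP (t - (g1 w q).2 \in N2)) => tN2; first by rewrite f1 // e3.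
  rewrite !gw2 -?e3 // addrC subrK; exact: eN.
have [tN1 tN2] := NP t w q tN.
by rewrite /h gw2 // addrC subrK gw1.
Qed.

End TuringMaps.

Definition RTM (d n k : nat) : Type :=
  {T : config d n k -> config d n k | reversible T}.

Section Group.
Variables d n k : nat.
Local Notation G := (RTM d n k).

Lemma RTM_eq (T S : G) : sval T =1 sval S -> T = S.
Proof. by case: T S => [T hT] [S hS] /= /funext E; apply: eq_exist. Qed.

Lemma reversible_id : reversible (@id (config d n k)).
Proof. by split; [|exists id; split]; try exact: is_turing_id. Qed.

Lemma reversible_comp (T S : config d n k -> config d n k) :
  reversible T -> reversible S -> reversible (T \o S).
Proof.
move=> [tT [T' [tT' TK T'K]]] [tS [S' [tS' SK S'K]]].
split; first exact: is_turing_comp.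
exists (S' \o T'); split; first exact: is_turing_comp.
  exact: can_comp.
exact: can_comp.
Qed.

Lemma reversible_inv (T : G) :
  exists S : G, cancel (sval T) (sval S) /\ cancel (sval S) (sval T).
Proof.
case: T => T [tT [S [tS TK SK]]] /=.
have rS : reversible S by split=> //; exists T.
by exists (exist _ S rS).
Qed.

Definition RTM_one : G := exist _ id reversible_id.
(* T * S is composition of maps, S being applied first. *)
Definition RTM_mul (T S : G) : G :=
  exist _ (sval T \o sval S) (reversible_comp (svalP T) (svalP S)).
Definition RTM_inv (T : G) : G := sval (cid (reversible_inv T)).

Lemma RTM_mulA : associative RTM_mul.
Proof. by move=> T S U; apply: RTM_eq. Qed.
Lemma RTM_mul1 : left_id RTM_one RTM_mul.
Proof. by move=> T; apply: RTM_eq. Qed.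
Lemma RTM_mulr1 : right_id RTM_one RTM_mul.
Proof. by move=> T; apply: RTM_eq. Qed.
Lemma RTM_mulV : left_inverse RTM_one RTM_inv RTM_mul.
Proof. by move=> T; apply: RTM_eq => c; apply: (svalP (cid (reversible_inv T))).1. Qed.
Lemma RTM_mulrV : right_inverse RTM_one RTM_inv RTM_mul.
Proof. by move=> T; apply: RTM_eq => c; apply: (svalP (cid (reversible_inv T))).2. Qed.

HB.instance Definition _ := gen_eqMixin G.
HB.instance Definition _ := gen_choiceMixin G.
HB.instance Definition _ :=
  isGroup.Build G RTM_mulA RTM_mul1 RTM_mulr1 RTM_mulV RTM_mulrV.

End Group.

Definition residually_finite (G : groupType) : Prop :=
  forall g : G, g != 1%g ->
    exists (H : finGroupType) (phi : {multiplicative G -> H}), phi g != 1%g.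

(* Main.v *)
Require Import Defs.
From mathcomp Require Import all_boot all_order all_algebra all_fingroup.
From mathcomp Require Import finmap gseries alt boolp.

Set Implicit Arguments.
Unset Strict Implicit.
Unset Printing Implicit Defensive.

Import GRing.Theory.

(** The permutations of the window contents [Sigma ^ F], applied at the head,
    form a copy of the symmetric group on [n ^ #|F|] points inside the group of
    reversible machines.  As [F] grows, a finite quotient [H] eventually becomes
    smaller than the alternating group, which is simple and hence killed by the
    map to [H].  A square of a machine acting on two cells is an even permutation
    of every larger window, so it dies in all finite quotients. *)

(** The kernel meets the simple group ['Alt_T] in a normal subgroup, so [f] is injective or trivial
    on ['Alt_T]. Injectivity would give |T|! <= 2|H| < |T|, which is absurd. *)
Lemma morph_Alt_trivial (T : finType) (H : finGroupType)
    (f : {morphism [set: {perm T}] >-> H}) :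
  4 < #|T| -> #|H|.*2 < #|T| -> forall s, s \in ('Alt_T)%g -> f s = 1%g.
Proof.
move=> T5 HT s sA.
have /simpleP[_ /(_ ('ker_('Alt_T) f)%G)[|K1|KA]] := simple_Alt5 T5.
- by apply: normalGI (ker_normal f); apply: subsetT.
- have inj : {in ('Alt_T)%g &, injective f}.
    apply/(injmP (f := restrm_morphism (subsetT ('Alt_T)%g) f)).
    by rewrite ker_restrm K1.
  have := leq_card_in _ _ inj; rewrite -leq_double -mul2n card_Alt ?(ltn_trans _ T5) //.
  by rewrite leqNgt (leq_trans HT) // fact_geq.
- by move: sA; rewrite -KA inE => /andP[_ /mker].
Qed.

Lemma Alt_sq (T : finType) (s : {perm T}) : (s * s)%g \in ('Alt_T)%g.
Proof. by rewrite Alt_even odd_permM addbb. Qed.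

Section Window.
Variables (d n k : nat) (F : {fset Zd d}).
Local Notation pattern := {ffun F -> 'I_n}.
Implicit Type s : {perm pattern}.

Definition window_map s : config d n k -> config d n k :=
  @turing_map d n k F F (fun a => (s a.1, a.2, 0%R)).

Global Arguments window_map : simpl never.

Lemma window_map0 s x : window_map s (x, head0 d k) = (x, head0 d k).
Proof. exact: turing_map0. Qed.

Lemma window_mapE s x q v :
  window_map s (x, head_at q v) =
    (fun t => if insub (t - v)%R is Some u
              then s [ffun u : F => x (v + val u)%R] u else x t,
     head_at q v).
Proof. by rewrite /window_map turing_mapE /= addr0. Qed.

(** The head stays put, so the second map reads exactly the pattern that the first one wrote. *)
Lemma window_mapM s s' c :
  window_map (s * s')%g c = window_map s' (window_map s c).
Proof.
case: c => x y; have [->|[q [v ->]]] := headP y.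
  by rewrite !window_map0.
rewrite !window_mapE; congr pair; apply: funext => t.
rewrite permM; case: insubP => // u _ _; congr (fun_of_fin (s' _) u).
apply/ffunP => w; rewrite !ffunE.
by rewrite addrC addKr valK.
Qed.

Lemma window_map1 : window_map 1%g =1 id.
Proof.
case=> x y; have [->|[q [v ->]]] := headP y.
  by rewrite !window_map0.
rewrite !window_mapE; congr pair; apply: funext => t.
by case: insubP => // u _ uE; rewrite perm1 ffunE uE addrC subrK.
Qed.

Lemma window_map_reversible s : reversible (window_map s).
Proof.
have turing s' : is_turing (window_map s') by exists F, F; eexists.
split=> //; exists (window_map s^-1%g).
by split=> // c; rewrite -window_mapM ?mulgV ?mulVg window_map1.
Qed.

(* Permutations multiply left to right and maps right to left, whence the
   inverse. *)
Definition window_perm s : RTM d n k :=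
  exist _ _ (window_map_reversible s^-1%g).

Lemma window_permM : {morph window_perm : s s' / (s * s')%g}.
Proof. by move=> s s'; apply: RTM_eq => c /=; rewrite invMg window_mapM. Qed.

Section QuarterTurn.
Variables (a b : F) (ab : a != b) (tau : {perm 'I_n}).

(** On the cells [a] and [b] this is (x, y) |-> (y, tau x), modelled on the plane rotation (x, y)
    |-> (y, -x): a square root of applying [tau] to both cells. *)
Definition quarter_turn_fun (p : pattern) : pattern :=
  [ffun u => if u == a then p b else if u == b then tau (p a) else p u].

Lemma quarter_turn_inj : injective quarter_turn_fun.
Proof.
move=> p p' /ffunP E; apply/ffunP => u.
have [-> | ua] := eqVneq u a.
  by have := E b; rewrite !ffunE eq_sym (negPf ab) eqxx => /perm_inj.
have [-> | ub] := eqVneq u b; first by have := E a; rewrite !ffunE eqxx.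
by have := E u; rewrite !ffunE (negPf ua) (negPf ub).
Qed.

Definition quarter_turn := perm quarter_turn_inj.

Lemma quarter_turn_sqE p u :
  (quarter_turn * quarter_turn)%g p u =
    if (u == a) || (u == b) then tau (p u) else p u.
Proof.
rewrite permM !permE !ffunE; have [-> | ua] := eqVneq u a.
  by rewrite eq_sym (negPf ab) eqxx.
by rewrite eqxx; have [-> | ub] := eqVneq u b.
Qed.

(** The right-hand side depends on [F] only through the positions of [a] and [b], so all windows
    containing these two cells yield the same machine. *)
Lemma window_map_quarter_turn_sqE x q v :
  window_map (quarter_turn * quarter_turn)%g (x, head_at q v) =
    (fun t => if (t - v == val a)%R || (t - v == val b)%R
              then tau (x t) else x t,
     head_at q v).
Proof.
rewrite window_mapE; congr pair; apply: funext => t; case: insubP => [u _ uE|].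
  by rewrite quarter_turn_sqE ffunE -!val_eqE uE [(v + _)%R]addrC subrK.
by case: eqP => [->|_]; rewrite ?(valP a) //; case: eqP => [->|]; rewrite ?(valP b).
Qed.

End QuarterTurn.

End Window.

Lemma window_perm_finite_quotient (d n k : nat) (F : {fset Zd d})
    (H : finGroupType) (phi : {multiplicative RTM d n k -> H}) :
  4 < #|{ffun F -> 'I_n}| -> #|H|.*2 < #|{ffun F -> 'I_n}| ->
  forall s : {perm {ffun F -> 'I_n}}, s \in ('Alt_{ffun F -> 'I_n})%g ->
    phi (window_perm k s) = 1%g.
Proof.
move=> T5 HT.
have fM : {in [set: {perm {ffun F -> 'I_n}}] &,
    {morph phi \o @window_perm d n k F : s s' / (s * s')%g}}.
  by move=> s s' _ _; rewrite /= window_permM gmulfM.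
exact: (morph_Alt_trivial (Morphism fM)).
Qed.

Theorem mainTheorem6 (n k d : nat) (hn : 2 <= n) (hk : 1 <= k) (hd : 1 <= d) :
  ~ residually_finite (RTM d n k).
Proof.
move=> rf.
pose pos (i : nat) : Zd d := const_mx (Posz i).
have pos_inj : injective pos.
  by move=> i j /matrixP/(_ ord0 (Ordinal hd)); rewrite !mxE => -[].
(* Diagonal windows of N + 2 cells, so that [pos 0] and [pos 1] always belong to them. *)
pose F N := [fset pos (val i) | i : 'I_N.+2]%fset.
have F0 N : pos 0 \in F N by apply/imfsetP; exists ord0.
have F1 N : pos 1 \in F N by apply/imfsetP; exists (lift ord0 ord0).
have cardF N : #|{: F N}| = N.+2.
  rewrite -cardfE card_imfset /=; first by rewrite size_enum_ord.
  by move=> i j /pos_inj/val_inj.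
pose a N : F N := [` F0 N]%fset; pose b N : F N := [` F1 N]%fset.
have ab N : a N != b N by rewrite -val_eqE /=; apply/eqP => /pos_inj.
pose s0 : 'I_n := Ordinal (ltnW hn); pose s1 : 'I_n := Ordinal hn.
pose r N := quarter_turn (ab N) (tperm s0 s1).
(* The inverses cancel the one in [window_perm]; the argument is still a square, hence even. *)
pose g N := window_perm k ((r N)^-1 * (r N)^-1)%g.
have gE N x q v : sval (g N) (x, head_at q v) =
    (fun t => if ((t - v)%R == pos 0) || ((t - v)%R == pos 1)
              then tperm s0 s1 (x t) else x t, head_at q v).
  by rewrite /= invMg invgK window_map_quarter_turn_sqE.
have g_indep N : g N = g 0.
  apply: RTM_eq => -[x y]; have [->|[q [v ->]]] := headP y; last by rewrite !gE.
  by rewrite /= !window_map0.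
(* On the constant tape [s0], the machine writes [s1] under the head. *)
have g_neq1 : g 0 != 1%g.
  have q : state k by exists (Ordinal (hk : 1 < k.+1)).
  apply/eqP => /(congr1 sval)/(congr1 (fun T => T (fun=> s0, head_at q 0%R))).
  rewrite gE => /(congr1 fst)/(congr1 (fun x => x (pos 0))) /=.
  by rewrite subr0 eqxx tpermL => /(congr1 val).
have [H [phi /eqP[]]] := rf _ g_neq1.
(* There are n^(N+2) > N patterns, and N bounds both 4 and 2|H|, as the quotient lemma requires. *)
pose N := (#|H|.*2 + 4)%N; rewrite -(g_indep N).
have big : N < #|{ffun F N -> 'I_n}|.
  rewrite card_ffun cardF card_ord (leq_trans (ltn_expl N hn)) //.
  by rewrite leq_pexp2l ?(ltnW hn) // -addn2 leq_addr.
apply: window_perm_finite_quotient (Alt_sq _).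
  by rewrite (leq_ltn_trans _ big) // leq_addl.
by rewrite (leq_ltn_trans _ big) // leq_addr.
Qed.
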